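(* Consider the random intersection graph $G(n,m,F)$ defined in the context, with $m=\lfloor\beta n^\alpha\rfloor$ and $p_i=\gamma W_i n^{-(1+\alpha)/2}\wedge 1$, and assume $F$ has finite mean. Let $i,j,k$ be three distinct vertices and let $\bar c^{(n)}_{i,j,k}=\bar{\mathbf P}_n(E_{ij}\mid E_{ik}\cap E_{jk})$. Then as $n\to\infty$: (a) if $\alpha<1$, $\bar c^{(n)}_{i,j,k}\to 1$ in probability; (b) if $\alpha=1$, $\bar c^{(n)}_{i,j,k}\to (1+\beta\gamma W_k)^{-1}$ in probability; (c) if $\alpha>1$, $\bar c^{(n)}_{i,j,k}\to 0$ in probability.
   Context: Model $G(n,m,F)$: fix constants $\alpha,\beta,\gamma>0$ and a probability distribution $F$ on $(0,\infty)$; if $F$ has finite mean it is assumed to have mean $1$. For a positive integer $n$ let $m=\lfloor\beta n^\alpha\rfloor$, let $\mathcal V=\{1,\dots,n\}$ (vertices, ''individuals'') and $\mathcal A$ a set of $m$ elements (''groups''). Let $W_1,\dots,W_n$ be i.i.d. with distribution $F$ and set $p_i=\gamma W_i n^{-(1+\alpha)/2}\wedge 1$. Conditionally on the weights, form a bipartite graph $B(n,m,F)$ on $\mathcal V\cup\mathcal A$ by including each edge between $i\in\mathcal V$ and $a\in\mathcal A$ independently with probability $p_i$. The graph $G(n,m,F)$ on $\mathcal V$ has an edge between distinct $i,j$ iff some $a\in\mathcal A$ is adjacent to both $i$ and $j$ in $B(n,m,F)$. The parameters $\alpha,\beta,\gamma,F$ do not depend on $n$. $\bar{\mathbf P}_n$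 denotes the law of $B(n,m,F)$ conditional on the weights $W_1,\dots,W_n$, and $E_{ij}$ is the event that $i$ and $j$ belong to a common group (equivalently, $\{i,j\}$ is an edge of $G(n,m,F)$). Thus $\bar c^{(n)}_{i,j,k}$ is a random variable (a function of the weights). *)

(* Defs.v *)
From HB Require Import structures.
From mathcomp Require Import all_boot all_order all_algebra.
From mathcomp Require Import all_classical all_reals all_analysis.
Set Implicit Arguments. Unset Strict Implicit. Unset Printing Implicit Defensive.
Import Order.TTheory GRing.Theory Num.Theory.
Local Open Scope classical_set_scope.
Local Open Scope ring_scope.

Section RIG.
Variable R : realType.

Definition ngroups (alpha beta : R) (n : nat) : nat :=
  Num.truncn (beta * (n%:R `^ alpha)).

Definition incl_prob (alpha gamma : R) (n : nat) (w : R) : R :=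
  Num.min (gamma * w * (n%:R `^ (- ((1 + alpha) / 2)))) 1.

(* A bipartite graph between vertices 'I_n and groups 'I_m is a 0/1 matrix. *)
Definition bigraph (n m : nat) := {ffun 'I_n * 'I_m -> bool}.

(* Law of B(n,m,F) conditional on the weights (p l = inclusion probability
   of vertex l, edges independent): probability of an event E. *)
Definition Pbar (n m : nat) (p : nat -> R) (E : pred (bigraph n m)) : R :=
  \sum_(B : bigraph n m | E B)
     \prod_(x : 'I_n * 'I_m) (if B x then p (val x.1) else 1 - p (val x.1)).

Definition Eedge (n m : nat) (i j : nat) (B : bigraph n m) : bool :=
  [exists a : 'I_m, exists u : 'I_n, exists v : 'I_n,
     [&& val u == i, val v == j, B (u, a) & B (v, a)]].

Definition cbar (alpha beta gamma : R) (n : nat) (w : nat -> R)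
    (i j k : nat) : R :=
  let m := ngroups alpha beta n in
  let p := fun l => incl_prob alpha gamma n (w l) in
  Pbar p (fun B : bigraph n m => [&& Eedge i j B, Eedge i k B & Eedge j k B])
  / Pbar p (fun B : bigraph n m => Eedge i k B && Eedge j k B).

End RIG.

Section Indep.
Set Strict Implicit.
Local Open Scope ereal_scope.
Definition mutually_independent_RVs (d : measure_display) (T : measurableType d)
    (R : realType) (P : probability T R) (X : nat -> {RV P >-> R}) : Prop :=
  forall (s : seq nat) (A : nat -> set R),
    uniq s -> (forall l, measurable (A l)) ->
    P (\bigcap_(l in [set` s]) (X l @^-1` A l)) =
    \prod_(l <- s) P (X l @^-1` A l).

Definition cvg_in_prob (d : measure_display) (T : measurableType d)
    (R : realType) (P : probability T R) (Y : nat -> T -> R) (Z : T -> R) :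
    Prop :=
  forall eps : R, (0 < eps)%R ->
    (fun n => P [set x | (eps < `| Y n x - Z x |)%R]) @ \oo --> 0.
End Indep.
Arguments cvg_in_prob {d T R} P Y Z.

(* Main.v *)
(** The ratio depends on the weights only through [W i], [W j], [W k], so for
    fixed positive weights its limit is a deterministic computation, and almost
    sure convergence gives convergence in probability (Egorov).

    Call a group of type S, for S a subset of {i, j, k}, when its members among
    i, j, k are exactly S.  The groups are independent, so the event that no
    group has its type in a given family has probability u^m, and
    inclusion-exclusion writes both probabilities in the ratio as T + D, where
    T = 1 - (1 - t)^m, t = p_i p_j p_k, is the probability that some group
    contains all of i, j, k, and D is an iterated difference of u |-> u^m.
    Asymptotically T ~ m p_i p_j p_k, the denominator has
    D ~ m^2 p_i p_j p_k^2, and the numerator has D = O(m^3 (p_i p_j p_k)^2),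
    negligible against the former since m p_i p_j -> 0.  The ratio therefore
    behaves like 1 / (1 + m p_k), with
    m p_k ~ beta gamma W_k n^((alpha - 1) / 2). *)

Require Import Defs.
From HB Require Import structures.
From mathcomp Require Import all_boot all_order all_algebra.
From mathcomp Require Import all_classical all_reals all_analysis.
From mathcomp Require Import measurable_realfun ring lra.
Import Order.TTheory GRing.Theory Num.Theory.
Import numFieldNormedType.Exports.
Local Open Scope classical_set_scope.
Local Open Scope ring_scope.

(** * Exact formulas for the two probabilities, by inclusion-exclusion over group types *)

Section Combinatorics.
Set Implicit Arguments.
Unset Strict Implicit.
Variable R : realType.
Implicit Types (n m i j k : nat) (p : nat -> R).

Definition coin (b : bool) (r : R) : R := if b then r else 1 - r.

Lemma coin_sum (r : R) : \sum_b coin b r = 1.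
Proof. by rewrite big_bool /coin /=; ring. Qed.

(** The columns of the matrix are independent with the same law, so a condition imposed on each
    group separately costs one factor per group. Currying a graph into its family of columns matches
    the sum over graphs with the expanded power. *)
Lemma Pbar_forall_groups n m p (phi : pred {ffun 'I_n -> bool}) :
  Pbar p (fun B : bigraph n m => [forall a, phi [ffun l => B (l, a)]]) =
  (\sum_(c | phi c) \prod_l coin (c l) (p (val l))) ^+ m.
Proof.
rewrite /Pbar -[in RHS](card_ord m) -prodr_const bigA_distr_big.
pose curry (B : bigraph n m) : {ffun 'I_m -> {ffun 'I_n -> bool}} :=
  [ffun a => [ffun l => B (l, a)]].
pose uncurry (f : {ffun 'I_m -> {ffun 'I_n -> bool}}) : bigraph n m :=
  [ffun x => f x.2 x.1].
rewrite (reindex curry) /=; last first.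
  exists uncurry => x _; first by apply/ffunP => -[l a]; rewrite !ffunE.
  by apply/ffunP => a; apply/ffunP => l; rewrite !ffunE.
apply: eq_big => [B|B _].
  apply/forallP/ffun_onP => h a; have := h a; rewrite ?ffunE //.
rewrite exchange_big pair_bigA /=; apply: eq_bigr => -[l a] _ /=.
by rewrite !ffunE.
Qed.

(** Group the columns by their values at i, j, k; every other vertex contributes a factor summing to
    1. *)
Lemma sum_coin3 n p (i j k : 'I_n) (phi : bool -> bool -> bool -> bool) :
  i != j -> i != k -> j != k ->
  \sum_(c : {ffun 'I_n -> bool} | phi (c i) (c j) (c k))
     \prod_l coin (c l) (p (val l)) =
  \sum_a \sum_b \sum_d (if phi a b d then
     coin a (p i) * coin b (p j) * coin d (p k) else 0).
Proof.
move=> ij ik jk.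
rewrite (partition_big (fun c : {ffun 'I_n -> bool} => (c i, c j, c k)) predT) //=.
transitivity (\sum_(t : bool * bool * bool) (if phi t.1.1 t.1.2 t.2 then
     coin t.1.1 (p i) * coin t.1.2 (p j) * coin t.2 (p k) else 0)); last first.
  by rewrite pair_bigA pair_bigA.
apply: eq_bigr => -[[a b] d] _ /=; case: ifP => h; last first.
  rewrite big_pred0 // => c; apply/negbTE/negP => /andP[h' /eqP[ea eb ed]].
  by move: h'; rewrite ea eb ed h.
(* [S l] holds the values allowed at [l]. The fibre over [(a, b, d)] is then a product of such sets,
   so the sum over it factors. *)
pose S (l : 'I_n) : pred bool := if l == i then pred1 a else if l == j then pred1 b
  else if l == k then pred1 d else predT.
rewrite (eq_bigl (fun c => c \in family S)); last first.
  move=> c; apply/andP/familyP => [[_ /eqP[ea eb ed]] l|hS].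
    rewrite /S; case: eqP => [->|_]; first by rewrite inE ea.
    case: eqP => [->|_]; first by rewrite inE eb.
    by case: eqP => [->|_]; first by rewrite inE ed.
  have := hS i; have := hS j; have := hS k.
  rewrite /S !eqxx !(eq_sym k) !(eq_sym j i) (negbTE ij) (negbTE ik) (negbTE jk).
  by rewrite !inE => /eqP-> /eqP-> /eqP->; rewrite h.
rewrite -(bigA_distr_big_dep S (fun l b => coin b (p (val l)))).
rewrite (bigD1 i) //= (bigD1 j) 1?eq_sym //= (bigD1 k) /=; last first.
  by rewrite !(eq_sym k) ik jk.
rewrite /S !eqxx !(eq_sym k) !(eq_sym j i) (negbTE ij) (negbTE ik) (negbTE jk).
rewrite !big_pred1_eq !mulrA [X in _ * X]big1 ?mulr1 // => l.
move=> /andP[/andP[/negbTE-> /negbTE->] /negbTE->].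
by rewrite -[RHS](coin_sum (p l)); apply: eq_bigl.
Qed.

Lemma EedgeE n m (i j : 'I_n) (B : bigraph n m) :
  Eedge i j B = [exists a, B (i, a) && B (j, a)].
Proof.
apply/existsP/existsP => -[a].
  case/existsP=> u /existsP[v] /and4P[/eqP/val_inj-> /eqP/val_inj-> Bi Bj].
  by exists a; rewrite Bi.
by move=> h; exists a; apply/existsP; exists i; apply/existsP; exists j; rewrite !eqxx.
Qed.

(** The booleans select the pairs to avoid. A group is admissible when its type contains no selected
    pair; the full type contains all pairs, so it is removed once as soon as one flag is set. *)
Lemma Pbar_avoid n m p (i j k : 'I_n) (x y z : bool) :
  i != j -> i != k -> j != k ->
  Pbar p (fun B : bigraph n m => [&& x ==> ~~ Eedge i j B, y ==> ~~ Eedge i k B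
    & z ==> ~~ Eedge j k B]) =
  (1 - [|| x, y | z]%:R * (p i * p j * p k) - x%:R * (p i * p j * (1 - p k))
     - y%:R * (p i * p k * (1 - p j)) - z%:R * (p j * p k * (1 - p i))) ^+ m.
Proof.
move=> ij ik jk.
transitivity ((\sum_a \sum_b \sum_d
     (if [&& x ==> ~~ (a && b), y ==> ~~ (a && d) & z ==> ~~ (b && d)] then
       coin a (p i) * coin b (p j) * coin d (p k) else 0)) ^+ m); last first.
  congr (_ ^+ _); rewrite !big_bool /coin /=.
  by case: x; case: y; case: z => /=; ring.
rewrite -(@sum_coin3 n p i j k (fun a b d => [&& x ==> ~~ (a && b),
  y ==> ~~ (a && d) & z ==> ~~ (b && d)]) ij ik jk).
rewrite -(@Pbar_forall_groups n m p (fun c => [&& x ==> ~~ (c i && c j),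
  y ==> ~~ (c i && c k) & z ==> ~~ (c j && c k)])).
apply: eq_bigl => B; rewrite !EedgeE !negb_exists.
apply/and3P/forallP => [[hx hy hz] a|h].
  rewrite !ffunE; apply/and3P; split; apply/implyP.
  - by move=> /(implyP hx)/forallP.
  - by move=> /(implyP hy)/forallP.
  - by move=> /(implyP hz)/forallP.
split; apply/implyP => t; apply/forallP => a; have := h a; rewrite !ffunE t /=.
- by case/and3P.
- by case/and3P.
- by case/and3P.
Qed.

(** With indicators under a common sum, linear relations between probabilities can be checked graph
    by graph. *)
Lemma PbarE n m p (E : pred (bigraph n m)) :
  Pbar p E = \sum_(B : bigraph n m) (E B)%:R *
    \prod_(x : 'I_n * 'I_m) (if B x then p (val x.1) else 1 - p (val x.1)).
Proof.
rewrite /Pbar big_mkcond; apply: eq_bigr => B _.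
by case: (E B); rewrite ?mul1r ?mul0r.
Qed.

(* With u = 1 - t and a, b, c the probabilities of the two-element types,
   [diff2] (resp. [diff3]) is the probability that no group contains all of
   i, j, k while both (resp. all three) of these types occur. *)
Definition diff2 (m : nat) (u a b : R) : R :=
  u ^+ m - (u - a) ^+ m - (u - b) ^+ m + (u - a - b) ^+ m.

Definition diff3 (m : nat) (u a b c : R) : R := diff2 m u a b - diff2 m (u - c) a b.

Section Inclusion_exclusion.
Variables (n m i j k : nat) (p : nat -> R).
Hypotheses (hi : (i < n)%N) (hj : (j < n)%N) (hk : (k < n)%N).
Hypotheses (ij : i != j) (ik : i != k) (jk : j != k).

Let avoid x y z (B : bigraph n m) : bool :=
  [&& x ==> ~~ Eedge i j B, y ==> ~~ Eedge i k B & z ==> ~~ Eedge j k B].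

Let avoidE x y z := @Pbar_avoid n m p (Ordinal hi) (Ordinal hj) (Ordinal hk) x y z ij ik jk.

(** Apart from the sure event [avoid false false false], every event of the expansion forbids the
    full type, so its base is u = 1 - t minus some two-element types. Adding and subtracting u^m
    separates 1 - u^m from an iterated difference. *)
Lemma Pbar_two_edges :
  Pbar p (fun B : bigraph n m => Eedge i k B && Eedge j k B) =
  1 - (1 - p i * p j * p k) ^+ m +
  diff2 m (1 - p i * p j * p k) (p i * p k * (1 - p j)) (p j * p k * (1 - p i)).
Proof.
transitivity (Pbar p (avoid false false false) - Pbar p (avoid false true false)
  - Pbar p (avoid false false true) + Pbar p (avoid false true true)).
  rewrite !PbarE -!sumrB -big_split /=; apply: eq_bigr => B _; rewrite /avoid.
  by case: (Eedge i k B); case: (Eedge j k B) => /=; ring.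
rewrite !avoidE /= /diff2 !mul0r !mul1r !subr0 expr1n.
by ring.
Qed.

Lemma Pbar_three_edges :
  Pbar p (fun B : bigraph n m => [&& Eedge i j B, Eedge i k B & Eedge j k B]) =
  1 - (1 - p i * p j * p k) ^+ m +
  diff3 m (1 - p i * p j * p k) (p i * p k * (1 - p j)) (p j * p k * (1 - p i))
    (p i * p j * (1 - p k)).
Proof.
transitivity (Pbar p (avoid false false false) - Pbar p (avoid true false false)
  - Pbar p (avoid false true false) - Pbar p (avoid false false true)
  + Pbar p (avoid true true false) + Pbar p (avoid true false true)
  + Pbar p (avoid false true true) - Pbar p (avoid true true true)).
  rewrite !PbarE -!sumrB -!big_split /= -!sumrB; apply: eq_bigr => B _; rewrite /avoid.
  by case: (Eedge i j B); case: (Eedge i k B); case: (Eedge j k B) => /=; ring.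
rewrite !avoidE /= /diff3 /diff2 !mul0r !mul1r !subr0 expr1n.
by ring.
Qed.

End Inclusion_exclusion.

(** * Bounds on iterated differences of u^m *)

Lemma diff1_bounds m (u a : R) : 0 <= a -> 0 <= u - a -> u <= 1 ->
  m%:R * a * (u - a) ^+ m <= u ^+ m - (u - a) ^+ m <= m%:R * a.
Proof.
move=> a0 ua u1; have r1 : u - a <= 1 by lra.
elim: m => [|m /andP[IHl IHr]]; first by rewrite !expr0; lra.
have rm := exprn_ge0 m ua; have rm1 := exprn_ile1 m ua r1.
(* Telescoping: the difference is a sum of m terms, each [a] times powers of [u] and [u - a]; this
   peels off one of them. *)
have -> : u ^+ m.+1 - (u - a) ^+ m.+1 =
  u * (u ^+ m - (u - a) ^+ m) + a * (u - a) ^+ m by rewrite !exprS; ring.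
rewrite -natr1 exprS; set X := u ^+ m - _ in IHl IHr *.
set r := (u - a) ^+ m in rm rm1 IHl IHr *; set M := m%:R in IHl IHr *.
have M0 : 0 <= M by rewrite ler0n.
have X0 : 0 <= X by apply: le_trans IHl; rewrite !mulr_ge0.
apply/andP; split; last by nra.
have : (u - a) * (M * a * r) <= u * X by apply: ler_pM => //; [rewrite !mulr_ge0|lra].
have : (u - a) * (a * r) <= a * r by rewrite ler_piMl ?mulr_ge0.
by nra.
Qed.

(* Conditioning on the type of the last group. *)
Lemma diff2S m (u a b : R) : diff2 m.+1 u a b =
  (u - a - b) * diff2 m u a b + a * (u ^+ m - (u - b) ^+ m)
   + b * (u ^+ m - (u - a) ^+ m).
Proof. by rewrite /diff2 !exprS; ring. Qed.

Lemma diff3S m (u a b c : R) : diff3 m.+1 u a b c =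
  (u - a - b - c) * diff3 m u a b c + a * diff2 m u b c + b * diff2 m u a c
   + c * diff2 m u a b.
Proof.
rewrite /diff3 /diff2 !exprS !(addrAC u (- c)) !(addrAC (u - a) (- c)).
by ring.
Qed.

(** The factor m(m - 1) counts ordered pairs of distinct groups that can carry the two types; the
    upper bound relaxes it to m^2. Induction through [diff2S], with [diff1_bounds] for the mixed
    terms. *)
Lemma diff2_bounds m (u a b : R) :
  0 <= a -> 0 <= b -> 0 <= u - a - b -> u <= 1 ->
  m%:R * (m%:R - 1) * a * b * (u - a - b) ^+ m <= diff2 m u a b
    <= m%:R ^+ 2 * a * b.
Proof.
move=> a0 b0 ub u1; have r1 : u - a - b <= 1 by lra.
have ab0 : 0 <= a * b by exact: mulr_ge0.
elim: m => [|m /andP[IHl IHr]]; first by rewrite /diff2 !expr0; lra.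
have rm := exprn_ge0 m ub.
have /andP[al ar] : m%:R * a * (u - a) ^+ m <= u ^+ m - (u - a) ^+ m <= m%:R * a.
  by apply: diff1_bounds => //; lra.
have /andP[bl br] : m%:R * b * (u - b) ^+ m <= u ^+ m - (u - b) ^+ m <= m%:R * b.
  by apply: diff1_bounds => //; lra.
have al' : m%:R * a * (u - a - b) ^+ m <= m%:R * a * (u - a) ^+ m.
  by apply: ler_wpM2l; [rewrite mulr_ge0|apply: lerXn2r; rewrite ?nnegrE; lra].
have bl' : m%:R * b * (u - a - b) ^+ m <= m%:R * b * (u - b) ^+ m.
  by apply: ler_wpM2l; [rewrite mulr_ge0|apply: lerXn2r; rewrite ?nnegrE; lra].
have M0 : 0 <= m%:R :> R by rewrite ler0n.
have MM : 0 <= m%:R * (m%:R - 1) :> R.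
  by case: (m) => [|q]; rewrite ?mul0r // mulr_ge0 // subr_ge0 ler1n.
rewrite diff2S -natr1 exprS; move: IHl IHr al' bl' al ar bl br.
set X := u ^+ m - (u - a) ^+ m; set Y := u ^+ m - (u - b) ^+ m.
set Z := diff2 _ _ _ _; set r := (u - a - b) ^+ m in rm *.
set q := u - a - b in ub r1 *; set M : R := m%:R in M0 MM *.
move=> IHl IHr al' bl' al ar bl br.
have Z0 : 0 <= Z by apply: le_trans IHl; do 3 (apply: mulr_ge0 => //).
(* The two mixed terms contribute at least 2 M a b r, and M (M - 1) + 2 M = (M + 1) M. *)
have haY : a * (M * b * r) <= a * Y by apply: ler_wpM2l => //; lra.
have hbX : b * (M * a * r) <= b * X by apply: ler_wpM2l => //; lra.
have haY' : a * Y <= a * (M * b) by apply: ler_wpM2l.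
have hbX' : b * X <= b * (M * a) by apply: ler_wpM2l.
have hZ : q * (M * (M - 1) * a * b * r) <= q * Z by apply: ler_wpM2l.
have hZ' : q * Z <= Z by rewrite ler_piMl.
have hq : q * (2 * M * (a * b) * r) <= 2 * M * (a * b) * r.
  by rewrite ler_piMl // !mulr_ge0.
apply/andP; split; first by lra.
by rewrite expr2; lra.
Qed.

(** This term only has to be negligible against [diff2], so its order from above and its sign
    suffice. *)
Lemma diff3_bounds m (u a b c : R) :
  0 <= a -> 0 <= b -> 0 <= c -> 0 <= u - a - b - c -> u <= 1 ->
  0 <= diff3 m u a b c <= m%:R ^+ 3 * a * b * c.
Proof.
move=> a0 b0 c0 uc u1; have r1 : u - a - b - c <= 1 by lra.
have D2 m' (x y : R) : 0 <= x -> 0 <= y -> 0 <= u - x - y ->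
    0 <= diff2 m' u x y <= m'%:R ^+ 2 * x * y.
  move=> x0 y0 xy; have /andP[h ->] := @diff2_bounds m' u x y x0 y0 xy u1.
  rewrite andbT; apply: le_trans h; rewrite mulr_ge0 ?exprn_ge0 // mulr_ge0 // mulr_ge0 //.
  by case: (m') => [|q]; rewrite ?mul0r // !mulr_ge0 // subr_ge0 ler1n.
elim: m => [|m /andP[IHl IHr]]; first by rewrite /diff3 /diff2 !expr0; lra.
have /andP[bcl bcr] : 0 <= diff2 m u b c <= m%:R ^+ 2 * b * c by apply: D2 => //; lra.
have /andP[acl acr] : 0 <= diff2 m u a c <= m%:R ^+ 2 * a * c by apply: D2 => //; lra.
have /andP[abl abr] : 0 <= diff2 m u a b <= m%:R ^+ 2 * a * b by apply: D2 => //; lra.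
rewrite diff3S -natr1; apply/andP; split; first by rewrite !addr_ge0 // mulr_ge0.
have hD : (u - a - b - c) * diff3 m u a b c <= diff3 m u a b c by rewrite ler_piMl.
have ha := ler_wpM2l a0 bcr; have hb := ler_wpM2l b0 acr.
have hc := ler_wpM2l c0 abr.
have habc : 0 <= a * b * c by rewrite !mulr_ge0.
(* The mixed terms add at most 3 m^2 a b c, and (m + 1)^3 - m^3 - 3 m^2 = 3 m + 1 is the slack. *)
have : 0 <= (3 * m%:R + 1) * (a * b * c) by rewrite mulr_ge0 // addr_ge0 ?mulr_ge0.
move: ha hb hc IHr habc hD; move: (m%:R) => M; move: (diff3 _ _ _ _ _) => D.
move: (diff2 _ _ _ _) (diff2 _ _ _ _) (diff2 _ _ _ _) => A B C.
by rewrite !exprS !expr0 !mulr1; lra.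
Qed.
End Combinatorics.

(** * Asymptotics of the ratio when the inclusion probabilities share one scale *)

Section Limits.
Set Implicit Arguments.
Unset Strict Implicit.
Variable R : realType.

Lemma near_eq_cvg_to (v u : nat -> R) (l : R) :
  (\forall n \near \oo, u n = v n) -> v @ \oo --> l -> u @ \oo --> l.
Proof.
move=> uv; apply: cvg_trans; apply: near_eq_cvg.
by apply: filterS uv => n ->.
Qed.

Lemma bernoulli_ge m (t : R) : 0 <= t <= 1 -> 1 - m%:R * t <= (1 - t) ^+ m.
Proof.
move=> /andP[t0 t1].
have /andP[_] : m%:R * t * (1 - t) ^+ m <= 1 ^+ m - (1 - t) ^+ m <= m%:R * t.
  by apply: diff1_bounds; lra.
by rewrite expr1n; lra.
Qed.

(** Probabilities at most 1/4 give t at most 1/4 and a, b, c at most 1/16, which keeps every base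
    nonnegative. Bernoulli then makes the powers in the lower bounds linear, in a form whose limit
    is visible. *)
Lemma edge_type_bounds m (p q r : R) (t := p * q * r)
    (a := p * r * (1 - q)) (b := q * r * (1 - p)) (c := p * q * (1 - r)) :
  0 < p <= 4^-1 -> 0 < q <= 4^-1 -> 0 < r <= 4^-1 ->
  [/\ m%:R * t * (1 - m%:R * t) <= 1 - (1 - t) ^+ m <= m%:R * t,
   m%:R * (m%:R - 1) * a * b * (1 - m%:R * (t + a + b)) <= diff2 m (1 - t) a b
     <= m%:R ^+ 2 * a * b
   & 0 <= diff3 m (1 - t) a b c <= m%:R ^+ 3 * a * b * c].
Proof.
move=> /andP[p0 p1] /andP[q0 q1] /andP[r0 r1].
have pair (x y z : R) : 0 < x -> x <= 4^-1 -> 0 < y -> y <= 4^-1 -> 0 < z -> z <= 4^-1 ->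
    0 <= x * y * (1 - z) <= 16^-1.
  move=> x0 x1 y0 y1 z0 z1.
  have h1 : 0 <= x * y by rewrite mulr_ge0 ?ltW.
  have h2 : x * y <= 4^-1 * 4^-1 by apply: ler_pM; lra.
  have h3 : 0 <= x * y * (1 - z) by rewrite mulr_ge0 //; lra.
  have h4 : x * y * (1 - z) <= x * y by rewrite ler_piMr //; lra.
  by rewrite h3; lra.
have /andP[a0 a1] : 0 <= a <= 16^-1 by exact: pair.
have /andP[b0 b1] : 0 <= b <= 16^-1 by exact: pair.
have /andP[c0 c1] : 0 <= c <= 16^-1 by exact: pair.
have t0 : 0 <= t by rewrite !mulr_ge0 ?ltW.
have t1 : t <= 4^-1.
  have : p * q <= 1 * 1 by apply: ler_pM; lra.
  rewrite mulr1 => pq1; have : p * q * r <= 1 * r by rewrite ler_wpM2r // ltW.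
  by rewrite /t; lra.
have M0 : 0 <= m%:R :> R by [].
split; last by apply: diff3_bounds => //; lra.
- have /andP[l h] : m%:R * t * (1 - t) ^+ m <= 1 ^+ m - (1 - t) ^+ m <= m%:R * t.
    by apply: diff1_bounds; lra.
  rewrite expr1n in l h; rewrite h andbT (le_trans _ l) //.
  by apply: ler_wpM2l; [rewrite mulr_ge0|apply: bernoulli_ge; lra].
- have /andP[l h] := @diff2_bounds R m (1 - t) a b a0 b0 ltac:(lra) ltac:(lra).
  rewrite h andbT (le_trans _ l) //; apply: ler_wpM2l.
    rewrite mulr_ge0 // mulr_ge0 //.
    by case: (m) => [|k]; rewrite ?mul0r // mulr_ge0 // subr_ge0 ler1n.
  have -> : 1 - t - a - b = 1 - (t + a + b) by ring.
  by apply: bernoulli_ge; lra.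
Qed.

(** [f], [g], [h] stand for [gamma] times the weights of i, j, k, and [x n] for the common scale, so
    that [f * x n] is an inclusion probability. *)
Variables (m : nat -> nat) (x : nat -> R) (f g h : R).
Hypotheses (f0 : 0 < f) (g0 : 0 < g) (h0 : 0 < h).
Hypothesis x_gt0 : \forall n \near \oo, 0 < x n.
Hypothesis m_gt0 : \forall n \near \oo, (0 < m n)%N.
Hypothesis cvg_x : x @ \oo --> (0 : R).
Hypothesis cvg_mV : (fun n => (m n)%:R^-1 : R) @ \oo --> (0 : R).
Hypothesis cvg_mx2 : (fun n => (m n)%:R * x n ^+ 2 : R) @ \oo --> (0 : R).

Let t n : R := f * x n * (g * x n) * (h * x n).
Let a n : R := f * x n * (h * x n) * (1 - g * x n).
Let b n : R := g * x n * (h * x n) * (1 - f * x n).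
Let c n : R := f * x n * (g * x n) * (1 - h * x n).

Let small (e : R) : 0 < e -> \forall n \near \oo, 0 < e * x n <= 4^-1.
Proof.
move=> e0; near=> n; have xn : 0 < x n by near: n.
rewrite mulr_gt0 //= mulrC -ler_pdivlMr //.
by near: n; apply: (cvgr_le 0) => //; rewrite divr_gt0.
Unshelve. all: end_near. Qed.

Let cvg_t : (fun n => (m n)%:R * t n) @ \oo --> (0 : R).
Proof.
rewrite (_ : (fun n => _) = (fun n => (m n)%:R * x n ^+ 2 * (f * g * h * x n))); last first.
  by apply/funext => n; rewrite /t; ring.
rewrite -[X in _ --> X](mul0r (f * g * h * 0)).
by apply: cvgM => //; apply: cvgM => //; exact: cvg_cst.
Qed.

Let cvg_1B (e : R) : (fun n => 1 - e * x n) @ \oo --> (1 : R).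
Proof.
rewrite -[X in _ --> X]subr0 -[X in _ --> _ - X](mulr0 e).
by apply: cvgB; [exact: cvg_cst|apply: cvgM => //; exact: cvg_cst].
Qed.

Let cvg_tab : (fun n => 1 - (m n)%:R * (t n + a n + b n)) @ \oo --> (1 : R).
Proof.
rewrite -[X in _ --> X]subr0; apply: cvgB; first exact: cvg_cst.
rewrite (_ : (fun n => _) = (fun n => (m n)%:R * t n + (m n)%:R * x n ^+ 2 *
   (f * h * (1 - g * x n) + g * h * (1 - f * x n)))); last first.
  by apply/funext => n; rewrite /t /a /b; ring.
rewrite -[X in _ --> X]addr0; apply: cvgD => //.
rewrite -[X in _ --> X](mul0r (f * h * 1 + g * h * 1)).
by apply: cvgM => //; apply: cvgD; apply: cvgM => //; exact: cvg_cst.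
Qed.

(** [tau] and [delta] are the two parts of the denominator divided by their orders, m t and [wedge];
    [kappa] is the numerator's difference divided by [wedge]. The factor [y], which is m p_k, equals
    [wedge] over m t. *)
Let tau n : R := (1 - (1 - t n) ^+ m n) / ((m n)%:R * t n).
(* The order of [diff2]: two groups sharing k, one with i and one with j. *)
Let wedge n : R := (m n)%:R ^+ 2 * (f * g * h ^+ 2 * x n ^+ 4).
Let delta n : R := diff2 (m n) (1 - t n) (a n) (b n) / wedge n.
Let kappa n : R := diff3 (m n) (1 - t n) (a n) (b n) (c n) / wedge n.
Let y n : R := (m n)%:R * (h * x n).

Let cvg_tau : tau @ \oo --> (1 : R).
Proof.
apply: (@squeeze_cvgr _ _ _ _ (fun n => 1 - (m n)%:R * t n) (fun _ => 1)).
- near=> n.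
  have fx : 0 < f * x n <= 4^-1 by near: n; exact: small.
  have gx : 0 < g * x n <= 4^-1 by near: n; exact: small.
  have hx : 0 < h * x n <= 4^-1 by near: n; exact: small.
  have [/andP[lo hi] _ _] := edge_type_bounds (m n) fx gx hx.
  have mt : 0 < (m n)%:R * t n.
    rewrite mulr_gt0 ?ltr0n //; first by near: n.
    by case/andP: fx => ? _; case/andP: gx => ? _; case/andP: hx => ? _; do 2 apply: mulr_gt0 => //.
  by rewrite /tau ler_pdivlMr // ler_pdivrMr // mul1r mulrC lo hi.
- rewrite -[X in _ --> X]subr0; apply: cvgB => //; exact: cvg_cst.
- exact: cvg_cst.
Unshelve. all: end_near. Qed.

Let wedge_gt0 : \forall n \near \oo, 0 < wedge n.
Proof.
near=> n; have mn : (0 < m n)%N by near: n.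
have xn : 0 < x n by near: n.
by rewrite /wedge !mulr_gt0 // ?exprn_gt0 // ltr0n.
Unshelve. all: end_near. Qed.

Let cvg_delta : delta @ \oo --> (1 : R).
Proof.
(* As a b = f g h^2 x^4 (1 - g x)(1 - f x), dividing the bounds on [diff2] by [wedge] leaves exactly
   these two functions. *)
apply: (@squeeze_cvgr _ _ _ _
  (fun n => (1 - (m n)%:R^-1) * ((1 - g * x n) * (1 - f * x n)) *
     (1 - (m n)%:R * (t n + a n + b n)))
  (fun n => (1 - g * x n) * (1 - f * x n))).
- near=> n.
  have fx : 0 < f * x n <= 4^-1 by near: n; exact: small.
  have gx : 0 < g * x n <= 4^-1 by near: n; exact: small.
  have hx : 0 < h * x n <= 4^-1 by near: n; exact: small.
  have [_ /andP[lo hi] _] := edge_type_bounds (m n) fx gx hx.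
  have w0 : 0 < wedge n by near: n.
  have mn : (m n)%:R != 0 :> R by rewrite pnatr_eq0 -lt0n; near: n.
  rewrite /delta ler_pdivlMr // ler_pdivrMr //.
  apply/andP; split; [apply: le_trans lo|apply: (le_trans hi)].
  + by rewrite le_eqVlt; apply/orP; left; apply/eqP; rewrite /wedge /t /a /b; field.
  + by rewrite le_eqVlt; apply/orP; left; apply/eqP; rewrite /wedge /a /b; ring.
- rewrite -[X in _ --> X](mulr1 1); apply: cvgM => //.
  rewrite -[X in _ --> X](mulr1 1); apply: cvgM.
    by rewrite -[X in _ --> X]subr0; apply: cvgB => //; exact: cvg_cst.
  by rewrite -[X in _ --> X](mulr1 1); apply: cvgM.
- by rewrite -[X in _ --> X](mulr1 1); apply: cvgM.
Unshelve. all: end_near. Qed.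

(** The bound m^3 a b c exceeds the order of [wedge] by a factor of order m x^2, which tends to
    0. *)
Let cvg_kappa : kappa @ \oo --> (0 : R).
Proof.
apply: (@squeeze_cvgr _ _ _ _ (fun _ => 0) (fun n => (m n)%:R * x n ^+ 2 *
   (f * g * ((1 - g * x n) * (1 - f * x n) * (1 - h * x n))))).
- near=> n.
  have fx : 0 < f * x n <= 4^-1 by near: n; exact: small.
  have gx : 0 < g * x n <= 4^-1 by near: n; exact: small.
  have hx : 0 < h * x n <= 4^-1 by near: n; exact: small.
  have [_ _ /andP[lo hi]] := edge_type_bounds (m n) fx gx hx.
  have w0 : 0 < wedge n by near: n.
  rewrite /kappa divr_ge0 ?(ltW w0) //= ler_pdivrMr //.
  apply: (le_trans hi).
  by rewrite le_eqVlt; apply/orP; left; apply/eqP; rewrite /wedge /a /b /c; ring.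
- exact: cvg_cst.
- rewrite -[X in _ --> X](mul0r (f * g * (1 * 1 * 1))).
  by apply: cvgM => //; apply: cvgM; [exact: cvg_cst|apply: cvgM => //; apply: cvgM].
Unshelve. all: end_near. Qed.

Definition clustering_ratio n : R :=
  (1 - (1 - t n) ^+ m n + diff3 (m n) (1 - t n) (a n) (b n) (c n)) /
  (1 - (1 - t n) ^+ m n + diff2 (m n) (1 - t n) (a n) (b n)).

Let ratioE : \forall n \near \oo,
  clustering_ratio n = (tau n + y n * kappa n) / (tau n + y n * delta n).
Proof.
near=> n; have mn : (m n)%:R != 0 :> R by rewrite pnatr_eq0 -lt0n; near: n.
have xn : x n != 0 by apply: lt0r_neq0; near: n.
have nz : (m n)%:R * t n != 0 by rewrite /t !mulf_neq0 // lt0r_neq0.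
have hz : h != 0 by rewrite lt0r_neq0.
have gz : g != 0 by rewrite lt0r_neq0.
have fz : f != 0 by rewrite lt0r_neq0.
have E (z : R) : y n * (z / wedge n) = z / ((m n)%:R * t n).
  by rewrite /y /wedge /t; field; rewrite ?mn ?xn ?hz ?gz ?fz.
by rewrite /kappa /delta /tau !E -!mulrDl invf_div mulrA divfK.
Unshelve. all: end_near. Qed.

Lemma clustering_ratio_cvg (l : R) : 0 <= l ->
  (fun n => (m n)%:R * (h * x n)) @ \oo --> l -> clustering_ratio @ \oo --> (1 + l)^-1.
Proof.
move=> l0 cvg_y; apply: (near_eq_cvg_to ratioE).
rewrite -[X in _ --> X]mul1r; apply: cvgM.
  rewrite -[X in _ --> X]addr0 -[X in _ --> _ + X](mulr0 l).
  by apply: cvgD => //; apply: cvgM.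
apply: cvgV; first by rewrite lt0r_neq0 // ltr_pwDl.
by apply: cvgD => //; rewrite -[X in _ --> X]mulr1; apply: cvgM.
Qed.

(** Here m p_k tends to infinity, so divide once more by [y]: the [tau] terms vanish, leaving
    [kappa] over [delta]. *)
Lemma clustering_ratio_cvg0 :
  (fun n => ((m n)%:R * (h * x n))^-1) @ \oo --> (0 : R) -> clustering_ratio @ \oo --> (0 : R).
Proof.
move=> cvg_y.
apply: (@near_eq_cvg_to (fun n => ((y n)^-1 * tau n + kappa n) /
    ((y n)^-1 * tau n + delta n))).
  near=> n.
  have -> : clustering_ratio n = (tau n + y n * kappa n) / (tau n + y n * delta n).
    by near: n.
  have yn : y n != 0.
    rewrite lt0r_neq0 // /y mulr_gt0 // ?ltr0n; first by near: n.
    by rewrite mulr_gt0 //; near: n.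
  have E (z : R) : tau n + y n * z = y n * ((y n)^-1 * tau n + z).
    by rewrite mulrDr mulVKf.
  by rewrite !E -mulf_div divff // mul1r.
have ytau0 : (fun n => (y n)^-1 * tau n) @ \oo --> (0 : R).
  by rewrite -[X in _ --> X](mul0r 1); apply: cvgM.
rewrite -[X in _ --> X](mul0r 1^-1); apply: cvgM.
  by rewrite -[X in _ --> X]addr0; apply: cvgD.
by apply: cvgV; rewrite ?oner_neq0 // -[X in _ --> X]add0r; apply: cvgD.
Unshelve. all: end_near. Qed.

End Limits.

(** * Growth of the number of groups against powers of n *)

Section Rates.
Set Implicit Arguments.
Unset Strict Implicit.
Variable R : realType.

Lemma cvg_natr_powRN (s : R) : 0 < s -> (fun n => n%:R `^ (- s) : R) @ \oo --> (0 : R).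
Proof.
move=> s0; apply/cvgrPdist_le => e e0; near=> n.
have n0 : (0 < n)%N by near: n; exact: nbhs_infty_gt.
rewrite sub0r normrN ger0_norm ?powR_ge0 //.
(* The threshold is the solution r of r^(-s) = e. *)
have : e `^ (- s^-1) <= n%:R by near: n; exact: nbhs_infty_ger.
have : 0 < e `^ (- s^-1) by exact: powR_gt0.
rewrite [X in _ -> _ -> _ <= X](_ : e = (e `^ (- s^-1)) `^ (- s)); last first.
  by rewrite -powRrM mulrNN mulVf ?gt_eqF // powRr1 // ltW.
move: (e `^ (- s^-1)) => r r0 rn; rewrite !powRN lef_pV2 ?posrE ?powR_gt0 ?ltr0n //.
by apply: ge0_ler_powR; rewrite ?nnegrE // ltW.
Unshelve. all: end_near. Qed.

Variables (alpha beta : R).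
Hypotheses (alpha0 : 0 < alpha) (beta0 : 0 < beta).

Let m := ngroups alpha beta.
Let x (n : nat) : R := n%:R `^ (- ((1 + alpha) / 2)).

(** Truncation loses less than 1, that is, n^(-alpha) after normalisation. *)
Lemma cvg_ngroups_ratio : (fun n => (m n)%:R * n%:R `^ (- alpha)) @ \oo --> beta.
Proof.
apply: (@squeeze_cvgr _ _ _ _ (fun n => beta - n%:R `^ (- alpha)) (fun _ => beta)).
- near=> n.
  have n0 : (0 < n)%N by near: n; exact: nbhs_infty_gt.
  have na : 0 < n%:R `^ alpha by apply: powR_gt0; rewrite ltr0n.
  have /andP[lo hi] := truncn_itv (ltW (mulr_gt0 beta0 na)).
  rewrite powRN ler_pdivrMr // lo andbT ler_pdivlMr // mulrBl mulVf ?gt_eqF //.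
  by move: hi; rewrite -natr1 -/(m n); rewrite /m /ngroups; lra.
- by rewrite -[X in _ --> X]subr0; apply: cvgB; [exact: cvg_cst|exact: cvg_natr_powRN].
- exact: cvg_cst.
Unshelve. all: end_near. Qed.

Lemma near_powR_gt0 (s : R) : \forall n \near \oo, 0 < n%:R `^ s :> R.
Proof.
near=> n; apply: powR_gt0; rewrite ltr0n; near: n; exact: nbhs_infty_gt.
Unshelve. all: end_near. Qed.

Lemma near_ngroups_gt0 : \forall n \near \oo, (0 < m n)%N.
Proof.
near=> n; rewrite lt0n; apply/negP => /eqP mn.
have : 0 < (m n)%:R * n%:R `^ (- alpha) :> R.
  by near: n; apply: (cvgr_gt beta) => //; exact: cvg_ngroups_ratio.
by rewrite mn mul0r ltxx.
Unshelve. all: end_near. Qed.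

(** Splitting off n^(-alpha) reduces other rates to [cvg_ngroups_ratio]: m n^s behaves like beta
    n^(-c). *)
Let scaling (c s : R) : c + s = - alpha ->
  \forall n \near \oo, (m n)%:R * n%:R `^ s = (m n)%:R * n%:R `^ (- alpha) * n%:R `^ (- c).
Proof.
move=> cs; near=> n; have n0 : (0 < n)%N by near: n; exact: nbhs_infty_gt.
rewrite -mulrA -powRD; first by rewrite -cs addrAC subrr add0r.
by apply/implyP => _; rewrite pnatr_eq0 -lt0n.
Unshelve. all: end_near. Qed.

Let cvg_scaling (c s l : R) : c + s = - alpha ->
  (fun n => n%:R `^ (- c) : R) @ \oo --> l ->
  (fun n => (m n)%:R * n%:R `^ s) @ \oo --> beta * l.
Proof.
move=> cs cl; apply: (near_eq_cvg_to (scaling cs)).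
by apply: cvgM => //; exact: cvg_ngroups_ratio.
Qed.

Lemma cvg_ngroupsV : (fun n => (m n)%:R^-1 : R) @ \oo --> (0 : R).
Proof.
apply: (@near_eq_cvg_to _ (fun n => ((m n)%:R * n%:R `^ (- alpha))^-1 *
   n%:R `^ (- alpha))).
  near=> n.
  have na : 0 < n%:R `^ (- alpha) :> R by near: n; exact: near_powR_gt0.
  by rewrite invfM -mulrA mulVf ?mulr1 // gt_eqF.
rewrite -[X in _ --> X](mulr0 beta^-1); apply: cvgM; last exact: cvg_natr_powRN.
by apply: cvgV; [rewrite gt_eqF|exact: cvg_ngroups_ratio].
Unshelve. all: end_near. Qed.

Lemma cvg_scale : x @ \oo --> (0 : R).
Proof. by apply: cvg_natr_powRN; rewrite divr_gt0 // addr_gt0. Qed.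

Lemma cvg_ngroups_scale2 : (fun n => (m n)%:R * x n ^+ 2) @ \oo --> (0 : R).
Proof.
rewrite (_ : (fun n => _) = (fun n => (m n)%:R * n%:R `^ (- (1 + alpha)))); last first.
  apply/funext => n; congr (_ * _); rewrite /x -powR_mulrn ?powR_ge0 // -powRrM.
  by congr (_ `^ _); field.
rewrite -[X in _ --> X](mulr0 beta); apply: (@cvg_scaling 1); first by ring.
exact: cvg_natr_powRN.
Qed.

Lemma cvg_ngroups_scale_lt1 : alpha < 1 -> (fun n => (m n)%:R * x n) @ \oo --> (0 : R).
Proof.
move=> a1; rewrite -[X in _ --> X](mulr0 beta).
apply: (@cvg_scaling ((1 - alpha) / 2)); first by field.
by apply: cvg_natr_powRN; lra.
Qed.

Lemma cvg_ngroups_scale_eq1 : alpha = 1 -> (fun n => (m n)%:R * x n) @ \oo --> beta.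
Proof.
move=> a1; rewrite -[X in _ --> X](mulr1 beta).
apply: (@cvg_scaling 0); first by rewrite a1; field.
by under eq_cvg do rewrite oppr0 powRr0; exact: cvg_cst.
Qed.

Lemma cvg_ngroups_scale_gt1 : 1 < alpha -> (fun n => ((m n)%:R * x n)^-1) @ \oo --> (0 : R).
Proof.
move=> a1; pose c := (alpha - 1) / 2.
apply: (@near_eq_cvg_to _ (fun n => ((m n)%:R * n%:R `^ (- alpha))^-1 * n%:R `^ (- c))).
  near=> n.
  have -> : (m n)%:R * x n = (m n)%:R * n%:R `^ (- alpha) * n%:R `^ (- - c).
    by near: n; apply: scaling; rewrite /c; field.
  by rewrite opprK (powRN _ c) -invfM.
rewrite -[X in _ --> X](mulr0 beta^-1); apply: cvgM; last first.
  by apply: cvg_natr_powRN; rewrite /c; lra.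
by apply: cvgV; [rewrite gt_eqF|exact: cvg_ngroups_ratio].
Unshelve. all: end_near. Qed.

End Rates.

(** * Limit of the conditional probability for fixed positive weights *)

Section Conditional.
Set Implicit Arguments.
Unset Strict Implicit.
Variables (R : realType) (alpha beta gamma : R) (i j k : nat) (w : nat -> R).
Hypotheses (alpha0 : 0 < alpha) (beta0 : 0 < beta) (gamma0 : 0 < gamma).
Hypotheses (ij : i != j) (ik : i != k) (jk : j != k).
Hypotheses (wi : 0 < w i) (wj : 0 < w j) (wk : 0 < w k).

Let x (n : nat) : R := n%:R `^ (- ((1 + alpha) / 2)).
Let ratio := clustering_ratio (ngroups alpha beta) x (gamma * w i) (gamma * w j) (gamma * w k).

(** For a fixed weight the scale tends to 0, so the cap at 1 is eventually inactive, from a rank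
    depending on [v]. *)
Lemma near_incl_prob (v : R) : 0 < v ->
  \forall n \near \oo, incl_prob alpha gamma n v = gamma * v * x n.
Proof.
move=> v0; near=> n; rewrite /incl_prob; apply/min_idPl; near: n.
apply: (cvgr_le 0) => //.
by rewrite -[X in _ --> X](mulr0 (gamma * v)); apply: cvgM; [exact: cvg_cst|exact: cvg_scale].
Unshelve. all: end_near. Qed.

Lemma near_cbarE :
  \forall n \near \oo, cbar alpha beta gamma n w i j k = ratio n.
Proof.
near=> n; rewrite /cbar.
have hi : (i < n)%N by near: n; exact: nbhs_infty_gt.
have hj : (j < n)%N by near: n; exact: nbhs_infty_gt.
have hk : (k < n)%N by near: n; exact: nbhs_infty_gt.
rewrite Pbar_three_edges // Pbar_two_edges //.
have -> : incl_prob alpha gamma n (w i) = gamma * w i * x n by near: n; exact: near_incl_prob.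
have -> : incl_prob alpha gamma n (w j) = gamma * w j * x n by near: n; exact: near_incl_prob.
have -> : incl_prob alpha gamma n (w k) = gamma * w k * x n by near: n; exact: near_incl_prob.
by [].
Unshelve. all: end_near. Qed.

(** Serves both alpha < 1, with [l] = 0, and alpha = 1, with [l] = beta. *)
Lemma cbar_cvg (l : R) : 0 <= l ->
  (fun n => (ngroups alpha beta n)%:R * x n) @ \oo --> l ->
  (fun n => cbar alpha beta gamma n w i j k) @ \oo --> (1 + l * (gamma * w k))^-1.
Proof.
move=> l0 cl; apply: (near_eq_cvg_to near_cbarE).
apply: clustering_ratio_cvg; rewrite ?mulr_gt0 //.
- exact: near_powR_gt0.
- exact: near_ngroups_gt0.
- exact: cvg_scale.
- exact: cvg_ngroupsV.
- exact: cvg_ngroups_scale2.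
- by rewrite mulr_ge0 // ltW // mulr_gt0.
- rewrite (_ : (fun n => _) = (fun n => (ngroups alpha beta n)%:R * x n * (gamma * w k))).
    by apply: cvgM => //; exact: cvg_cst.
  by apply/funext => n; ring.
Qed.

Lemma cbar_cvg0 :
  (fun n => ((ngroups alpha beta n)%:R * x n)^-1) @ \oo --> (0 : R) ->
  (fun n => cbar alpha beta gamma n w i j k) @ \oo --> (0 : R).
Proof.
move=> cl; apply: (near_eq_cvg_to near_cbarE).
apply: clustering_ratio_cvg0; rewrite ?mulr_gt0 //.
- exact: near_powR_gt0.
- exact: near_ngroups_gt0.
- exact: cvg_scale.
- exact: cvg_ngroupsV.
- exact: cvg_ngroups_scale2.
- rewrite (_ : (fun n => _) = (fun n => ((ngroups alpha beta n)%:R * x n)^-1 * (gamma * w k)^-1)).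
    by rewrite -[X in _ --> X](mul0r (gamma * w k)^-1); apply: cvgM => //; exact: cvg_cst.
  by apply/funext => n; rewrite -invfM; congr (_^-1); ring.
Qed.

End Conditional.

(** * Measurability, and convergence in probability from almost sure convergence *)

Section In_probability.
Set Implicit Arguments.
Unset Strict Implicit.
Context {R : realType} {d : measure_display} {T : measurableType d}.
Implicit Types (f : T -> R) (P : probability T R).

Lemma measurable_funV f : measurable_fun setT f -> measurable_fun setT (fun x => (f x)^-1).
Proof.
(* The square makes the base nonnegative, where [powR _ (-1)] is the inverse. *)
move=> mf; rewrite (_ : (fun x => _) = (fun x => f x * (f x ^+ 2) `^ (-1))).
  apply: measurable_funM => //.
  exact: measurableT_comp (measurable_powR _) (measurable_funX 2 mf).
apply/funext => x; rewrite powR_inv1 ?sqr_ge0 // expr2 invfM.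
by have [->|fx] := eqVneq (f x) 0; rewrite ?invr0 ?mul0r // mulrA divff // mul1r.
Qed.

(** By Egorov, convergence is uniform off a set [B] of measure below [e], so the deviation event
    eventually lies inside [B]. *)
Lemma ae_cvg_in_prob P (Y : nat -> T -> R) (Z : T -> R) :
  (forall n, measurable_fun setT (Y n)) -> measurable_fun setT Z ->
  {ae P, forall x, Y ^~ x @ \oo --> Z x} -> cvg_in_prob P Y Z.
Proof.
move=> mY mZ aeYZ eps eps0.
have mE n : measurable [set x | eps < `|Y n x - Z x|].
  rewrite -[X in measurable X]setTI.
  apply: (measurable_fun_ltr (f := fun _ => eps) (g := fun x => `|Y n x - Z x|)) => //.
  by apply: measurableT_comp => //; exact: measurable_funB.
apply/fine_cvgP; split; first by apply: nearW => n; exact: fin_num_measure.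
apply/cvgrPdist_le => e e0.
have finT : (P setT < +oo)%E by rewrite probability_setT ltry.
have aeYZ' : {ae P, forall x, setT x -> Y ^~ x @ \oo --> Z x}.
  by apply: filterS aeYZ => x h _.
have [B [mB Be unifB]] :=
  ae_pointwise_almost_uniform mY mZ measurableT finT aeYZ' e0.
have : nbhs (Y @ \oo) [set h | forall x, (setT `\` B) x -> `|Z x - h x| < eps].
  apply: (unifB); apply/uniform_nbhs.
  by exists [set uv | `|uv.1 - uv.2| < eps]; split=> //; exact: (entourage_ball _ (PosNum eps0)).
rewrite /= => near_unif; near=> n.
rewrite sub0r normrN ger0_norm ?fine_ge0 //.
rewrite -lee_fin fineK ?fin_num_measure //.
apply: le_trans (ltW Be); apply: le_measure; rewrite ?inE //.
move=> x /= hx; apply: contrapT => nB.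
have : forall x, (setT `\` B) x -> `|Z x - Y n x| < eps by near: n.
by move=> /(_ x); rewrite distrC ltNge (ltW hx) => /(_ (conj I nB)).
Unshelve. all: end_near. Qed.

Lemma measurable_Pbar n m (q : nat -> T -> R) (E : pred (bigraph n m)) :
  (forall l, measurable_fun setT (q l)) ->
  measurable_fun setT (fun x => Pbar (fun l => q l x) E).
Proof.
move=> mq; rewrite /Pbar; under eq_fun do rewrite big_mkcond.
apply: measurable_sum => B; case: (E B); last exact: measurable_cst.
apply: measurable_prod => x _; case: (B x); first exact: mq.
by apply: measurable_funB => //; exact: mq.
Qed.

Lemma measurable_cbar (alpha beta gamma : R) n (W : nat -> T -> R) i j k :
  (forall l, measurable_fun setT (W l)) ->
  measurable_fun setT (fun x => cbar alpha beta gamma n (fun l => W l x) i j k).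
Proof.
move=> mW; have mp l : measurable_fun setT (fun x => incl_prob alpha gamma n (W l x)).
  apply: measurable_minr => //; apply: measurable_funM => //.
  exact: measurable_funM.
apply: measurable_funM; first exact: measurable_Pbar mp.
by apply: measurable_funV; exact: measurable_Pbar mp.
Qed.

End In_probability.

(** * The three regimes of alpha *)

Theorem theorem1p3 (R : realType) (d : measure_display) (T : measurableType d)
    (P : probability T R) (F : probability R R) (W : nat -> {RV P >-> R})
    (alpha beta gamma : R) (i j k : nat) :
    0 < alpha -> 0 < beta -> 0 < gamma ->
    (* F is a distribution on (0, oo) *)
    F `]-oo, 0]%classic = 0%E ->
    (* F has finite mean, equal to 1 *)
    F.-integrable setT (fun x => x%:E) ->
    (\int[F]_x x%:E = 1)%E ->
    (* W_1, W_2, ... are i.i.d. with law F *)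
    mutually_independent_RVs W ->
    (forall l (A : set R), measurable A -> P (W l @^-1` A) = F A) ->
    (* i, j, k are three distinct vertices *)
    i != j -> i != k -> j != k ->
    let c := fun n x => cbar alpha beta gamma n (fun l => W l x) i j k in
    (alpha < 1 -> cvg_in_prob P c (fun _ => 1)) /\
    (alpha = 1 -> cvg_in_prob P c (fun x => (1 + beta * gamma * W k x)^-1)) /\
    (1 < alpha -> cvg_in_prob P c (fun _ => 0)).
Proof.
move=> alpha0 beta0 gamma0 F0 _ _ _ WF ij ik jk c.
have mW l : measurable_fun setT (W l) by [].
(* [F] gives no mass to the nonpositive reals, so each weight is almost surely positive. *)
have W_gt0 l : {ae P, forall x, 0 < W l x}.
  exists (W l @^-1` `]-oo, 0]%classic); split.
  - by rewrite -[X in measurable X]setTI; exact: mW.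
  - by rewrite WF.
  - by move=> x /= /negP; rewrite -leNgt in_itv.
have ae_pos : {ae P, forall x, [/\ 0 < W i x, 0 < W j x & 0 < W k x]}.
  by apply: filterS3 (W_gt0 i) (W_gt0 j) (W_gt0 k).
have mc n : measurable_fun setT (c n) by exact: measurable_cbar.
split; [move=> a1|split=> a1]; apply: ae_cvg_in_prob => //.
- apply: filterS ae_pos => x [wi wj wk].
  (* Writes the limit 1 as [(1 + 0 * (gamma * W k x))^-1], the shape of [cbar_cvg] at [l] = 0. *)
  rewrite -[1]invr1 -[in X in X^-1](addr0 1) -(mul0r (gamma * W k x)).
  by apply: cbar_cvg => //; exact: cvg_ngroups_scale_lt1.
- apply: measurable_funV; apply: measurable_funD => //.
  exact: measurable_funM.
- apply: filterS ae_pos => x [wi wj wk]; rewrite -mulrA.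
  by apply: cbar_cvg => //; [exact: ltW|exact: cvg_ngroups_scale_eq1].
- apply: filterS ae_pos => x [wi wj wk].
  by apply: cbar_cvg0 => //; exact: cvg_ngroups_scale_gt1.
Qed.
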